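(* Let $\varphi=\sup_k\mu_k$, where each $\mu_k$ ($k\in\mathbb{N}$) is a measure on $\mathbb{N}$ such that $\mu_k(\{n\})\leq1$ for all $n$ and $k$. Suppose the sequence of partitions associated to $(\mu_k)_k$ is eventually disjoint. If $\mathrm{FIN}(\varphi)$ is tall, then it has a Borel selector.
   Context: Measures are $\sigma$-additive measures on $\mathcal{P}(\mathbb{N})$, $\varphi(A)=\sup_k\mu_k(A)$, and $\mathrm{FIN}(\varphi)=\{A\subseteq\mathbb{N}:\varphi(A)<\infty\}$. The sequence of partitions associated to $(\mu_k)_k$ is $\mathcal{P}_n=\{A^n_i:i\in\mathbb{N}\cup\{\infty\}\}$, $n\in\mathbb{N}$, where $A^n_i=\{k\in\mathbb{N}:2^{-i-1}<\mu_k(\{n\})\leq2^{-i}\}$ for $i\in\mathbb{N}$ and $A^n_\infty=\{k\in\mathbb{N}:\mu_k(\{n\})=0\}$ (pieces may be empty). It is eventually disjoint if there is $p\in\mathbb{N}$ such that for all $n\neq m$ and all $i\in\mathbb{N}$ with $i>p$, $A^n_i\cap A^m_i=\emptyset$. A family $\mathcal{A}$ of subsets of $\mathbb{N}$ is tall if every infinite subset of $\mathbb{N}$ contains an infinite set in $\mathcal{A}$. A tall family $\mathcal{A}$ has a Borel selector if there is a Borel function $S:[\mathbb{N}]^\omega\to[\mathbb{N}]^\omega$ with $S(E)\subseteq E$ and $S(E)\in\mathcal{A}$ for all $E$, where $[\mathbb{N}]^\omega$ is the set of infinite subsets of $\mathbb{N}$ with the subspace topology from $2^{\mathbb{N}}$.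 *)

(* Defs.v *)
From HB Require Import structures.
From mathcomp Require Import all_boot all_order all_algebra.
From mathcomp Require Import all_classical all_reals all_analysis.

Set Implicit Arguments.
Unset Strict Implicit.
Unset Printing Implicit Defensive.

Import Order.TTheory GRing.Theory Num.Theory.
Import numFieldNormedType.Exports.

Local Open Scope classical_set_scope.
Local Open Scope ring_scope.
Local Open Scope ereal_scope.

(* The library equips nat with the discrete sigma-algebra, so a measure on
   nat is a sigma-additive measure on all subsets of nat. *)
Definition sup_measure (R : realType)
    (mu : nat -> {measure set nat -> \bar R}) (A : set nat) : \bar R :=
  ereal_sup (range (fun k => mu k A)).

Definition FIN (R : realType) (phi : set nat -> \bar R) : set (set nat) :=
  [set A | phi A < +oo].

(* [Some i] stands for the index i in nat, and [None] for the index oo. *)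
Definition assoc_partition (R : realType)
    (mu : nat -> {measure set nat -> \bar R}) (n : nat) (i : option nat) :
    set nat :=
  if i is Some j then
    [set k | ((2 ^- j.+1)%R%:E < mu k [set n]) /\
             (mu k [set n] <= (2 ^- j)%R%:E)]
  else [set k | mu k [set n] = 0].

Definition eventually_disjoint (P : nat -> option nat -> set nat) : Prop :=
  exists p : nat, forall n m i : nat, n <> m -> (p < i)%N ->
    P n (Some i) `&` P m (Some i) = set0.

Definition tall (F : set (set nat)) : Prop :=
  forall E : set nat, infinite_set E ->
    exists A : set nat, [/\ infinite_set A, A `<=` E & F A].

(* [cantor_space] is 2^nat with the product topology; [supp x] is the subset of
   nat with characteristic function x. *)
Definition supp (x : cantor_space) : set nat := [set n | x n = true].

Definition infinite_subsets : set cantor_space :=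
  [set x | infinite_set (supp x)].

(* A set coerced to a type carries the subspace topology. *)
Definition infsub : topologicalType := set_type infinite_subsets.

Definition infsub_set (E : infsub) : set nat := supp (set_val E).

(* [<<s @open X >>] is the Borel sigma-algebra of X; this is [measurable_fun]
   without the requirement that X and Y be pointed. *)
Definition borel_fun (X Y : topologicalType) (f : X -> Y) : Prop :=
  forall B : set Y, <<s @open Y >> B -> <<s @open X >> (f @^-1` B).

Definition has_borel_selector (F : set (set nat)) : Prop :=
  exists S : infsub -> infsub, borel_fun S /\
    forall E : infsub, infsub_set (S E) `<=` infsub_set E /\ F (infsub_set (S E)).

(* Main.v *)
Require Import Defs.
From HB Require Import structures.
From mathcomp Require Import all_boot all_order all_algebra.
From mathcomp Require Import all_classical all_reals all_analysis.
From mathcomp Require Import zify.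
Import Order.TTheory GRing.Theory Num.Theory.
Import numFieldNormedType.Exports.

Set Implicit Arguments.
Unset Strict Implicit.
Unset Printing Implicit Defensive.

(** Let p witness eventual disjointness and let B_k be the set of the n with
mu_k({n}) > 2^-(p+1).  The other points of positive mu_k-mass lie in pairwise
distinct dyadic shells, so together they weigh at most 2 ([small_part_le]).
Points of B_k weigh between 2^-(p+1) and 1.  Hence A is in FIN(phi) iff the
cardinals #|A /\ B_k| are bounded in k, that is, iff for some N no N-element
subset of A belongs to the family K of the finite sets contained in some B_k
([avoids_FIN], [FIN_avoids]).  What remains is a combinatorial statement about
an arbitrary family K of finite sets ([avoids_borel_selector]): if every
infinite set has an infinite subset without N-element subsets in K, for some
N, then such a subset can be selected in a Borel way.

The selection is an effective form of Ramsey's theorem.  Call C decided by an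
infinite set H if H is almost contained in C or in its complement.  Countably
many sets can be decided by one infinite subset of a given set, obtained by
repeated halving and a pseudo-intersection ([decideP]).  Starting from H_0 = E
and K_0 = K, let H_(j+1) be a subset of H_j that decides
{m | F + {m} in K_j} for all finite F, and put F in K_(j+1) when H_(j+1) is
almost contained in that set.  So the empty set is in K_j iff, for almost all
m_1, for almost all m_2, ..., for almost all m_j, the set {m_1, ..., m_j} is
in K, each quantifier being read along its own stage.

- If the empty set is in all K_j, then every infinite subset A of a
  pseudo-intersection of the H_j has, for each N, an N-element subset in K,
  picked point by point along the quantifiers: this contradicts tallness
  ([exists_stage_omits_nil]).
- If the empty set is not in K_j, then by the decisions made the negation
  passes through the quantifiers: for almost all m_1, ..., for almost all m_j,
  {m_1, ..., m_j} is not in K.  Each of these holds for almost all points of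
  H_j, so points of H_j can be picked greedily in such a way that no j-element
  set of picked points is in K ([thin_avoids]).

The selector applies the second point to the least possible j.  Everything is
defined from E by arithmetical formulas, that is, by quantification over
countable types and by least witnesses, and is therefore Borel in E.  The
contradiction with tallness alone uses sets without a definition from E. *)

Local Open Scope nat_scope.
Local Open Scope classical_set_scope.

(** * Unbounded sets and almost inclusion *)

Definition unbounded (A : set nat) := forall n, exists2 m, n <= m & A m.

Definition almost_sub (A C : set nat) :=
  exists n, forall m, n <= m -> A m -> C m.

Lemma infinite_unbounded (A : set nat) : infinite_set A <-> unbounded A.
Proof.
split=> [Ainf n|Aunb Afin].
  apply: contrapT => noA; apply: Ainf.
  apply: sub_finite_set (finite_II n) => m Am /=.
  by rewrite ltnNge; apply/negP => nm; apply: noA; exists m.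
have /finite_seqP[X AX] := Afin.
have [m + Am] := Aunb (\max_(n <- X) n).+1.
by rewrite ltnNge leq_bigmax_seq//; move: Am; rewrite AX.
Qed.

Lemma almost_sub_unbounded (A C : set nat) :
  unbounded A -> almost_sub A C -> unbounded (A `&` C).
Proof.
move=> Aunb [n nAC] k; have [m + Am] := Aunb (maxn n k).
rewrite geq_max => /andP[nm km]; exists m => //; split=> //; exact: nAC.
Qed.

Lemma almost_subS (A A' C C' : set nat) :
  A' `<=` A -> C `<=` C' -> almost_sub A C -> almost_sub A' C'.
Proof. by move=> AA CC [n nAC]; exists n => m nm /AA Am; apply/CC/nAC. Qed.

Lemma almost_sub_trans (A B C : set nat) :
  almost_sub A B -> almost_sub B C -> almost_sub A C.
Proof.
move=> [n nAB] [k kBC]; exists (maxn n k) => m.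
by rewrite geq_max => /andP[nm km] Am; apply/kBC/nAB.
Qed.

Lemma almost_subI (A B C : set nat) :
  almost_sub A B -> almost_sub A C -> almost_sub A (B `&` C).
Proof.
move=> [n nAB] [k kAC]; exists (maxn n k) => m.
by rewrite geq_max => /andP[nm km] Am; split; [apply: nAB|apply: kAC].
Qed.

Lemma almost_sub_above (A : set nat) (s : seq nat) :
  almost_sub A [set m | all (ltn^~ m) s].
Proof.
exists (\max_(n <- s) n).+1 => m sm _; apply/allP => n ns /=.
by apply: leq_ltn_trans sm; rewrite leq_bigmax_seq.
Qed.

(** * Greedy sequences *)

Definition admissible (P : seq nat -> set nat) (s : seq nat) : set nat :=
  P s `&` [set m | all (ltn^~ m) s].

(** A greedy sequence is listed with its latest point first.  Taking the least
admissible point, rather than any admissible one, determines the sequence from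
[P]; as a relation between [P] and a finite sequence it is arithmetical, which
is what makes [greedy_set] Borel in [P]. *)
Fixpoint greedy (P : seq nat -> set nat) (s : seq nat) : Prop :=
  if s is m :: s' then
    [/\ admissible P s' m, forall i, i < m -> ~ admissible P s' i & greedy P s']
  else True.

Definition greedy_set (P : seq nat -> set nat) : set nat :=
  [set n | exists2 s, greedy P s & n \in s].

(** Least witnesses leave no choice, so greedy sequences extend one another. *)
Lemma greedy_suffix P s t : greedy P s -> greedy P t -> size s <= size t ->
  exists u, t = u ++ s.
Proof.
elim: t s => [|b t IH] s.
  by rewrite leqn0 size_eq0 => _ _ /eqP ->; exists [::].
move=> gs gbt; have [_ _ gt] := gbt.
rewrite leq_eqVlt => /orP[|st]; last first.
  by have [u ->] := IH s gs gt st; exists (b :: u).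
case: s gs => // a s [adma mina gs]; rewrite /= eqSS => /eqP st.
have [u tus] := IH s gs gt (eq_leq st).
have u0 : u = [::].
  by apply/size0nil; move/(congr1 size): tus; rewrite size_cat; lia.
rewrite u0 /= in tus; subst t; exists [::] => /=; congr cons.
case: gbt => admb minb _; apply/eqP; rewrite eqn_leq.
apply/andP; split; rewrite leqNgt; apply/negP => h; first exact: minb h adma.
exact: mina h admb.
Qed.

Lemma greedy_exists P : (forall s, greedy P s -> unbounded (P s)) ->
  forall n, exists2 s, greedy P s & size s = n.
Proof.
move=> Punb; elim=> [|n [s gs sn]]; first by exists [::].
have Pex : exists m, `[< admissible P s m >].
  have [m _ adm] :=
    almost_sub_unbounded (Punb s gs) (almost_sub_above (P s) s) 0.
  by exists m; apply/asboolP.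
case: (ex_minnP Pex) => m /asboolP adm minm.
exists (m :: s); last by rewrite /= sn.
split=> // i im adi; have := minm i; rewrite leqNgt im => /(_ _)/negP.
by apply=> //; apply/asboolP.
Qed.

Lemma greedy_uniq P s : greedy P s -> uniq s.
Proof.
elim: s => // m s IH [[_ /= /allP sm] _ /IH ->]; rewrite andbT.
by apply/negP => /sm /=; rewrite ltnn.
Qed.

Lemma greedy_size P m s : greedy P (m :: s) -> size s <= m.
Proof.
elim: s m => // a s IH m [[_ /= /andP[am _]] _ /IH]; lia.
Qed.

Lemma greedy_set_unbounded P : (forall s, greedy P s -> unbounded (P s)) ->
  unbounded (greedy_set P).
Proof.
move=> /greedy_exists + n => /(_ n.+1) [[//|m s] gs [sn]]; exists m.
  by rewrite -sn; exact: greedy_size gs.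
by exists (m :: s); rewrite ?mem_head.
Qed.

Lemma greedy_set_seq P (F : seq nat) : (forall n, n \in F -> greedy_set P n) ->
  exists2 s : seq nat, greedy P s & {subset F <= s}.
Proof.
elim: F => [|n F IH] Fg; first by exists [::].
have [|s gs Fs] := IH; first by move=> m mF; apply: Fg; rewrite inE mF orbT.
have [t gt nt] := Fg n (mem_head _ _).
case: (leqP (size s) (size t)) => [|/ltnW] st.
  have [u tE] := greedy_suffix gs gt st; exists t => // m.
  by rewrite inE => /predU1P[->//|/Fs ms]; rewrite tE mem_cat ms orbT.
have [u sE] := greedy_suffix gt gs st; exists s => // m.
by rewrite inE => /predU1P[->|/Fs//]; rewrite sE mem_cat nt orbT.
Qed.

(** * Pseudo-intersections *)

(** The i-th greedy point is the least possible one of [E i]. *)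
Definition pseudo_inter (E : nat -> set nat) : set nat :=
  greedy_set (fun s => E (size s)).

Lemma decreasing_sub (E : nat -> set nat) : (forall i, E i.+1 `<=` E i) ->
  forall i j, i <= j -> E j `<=` E i.
Proof.
move=> Edec i j; elim: j => [|j IH]; first by rewrite leqn0 => /eqP ->.
by rewrite leq_eqVlt => /predU1P[->//|/IH h]; exact: subset_trans (@Edec j) h.
Qed.

(** The points picked after a greedy sequence of length i all come from sets
[E j] with i <= j; the points of that sequence itself are the exceptions. *)
Lemma pseudo_inter_almost (E : nat -> set nat) : (forall i, E i.+1 `<=` E i) ->
  (forall i, unbounded (E i)) -> forall i, almost_sub (pseudo_inter E) (E i).
Proof.
move=> Edec Eunb i.
have [s gs si] : exists2 s, greedy (fun s => E (size s)) s & size s = i.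
  by apply: greedy_exists => t _; exact: Eunb.
have [n nabove] := almost_sub_above (pseudo_inter E) s.
exists n => m nm mE; have /allP ms := nabove m nm mE.
(* m exceeds every point of s, so it was picked after s *)
have {}ms : m \notin s by apply/negP => /ms /=; rewrite ltnn.
case: mE => t gt mt; case: (leqP (size s) (size t)) => [|/ltnW] st; last first.
  have [u sE] := greedy_suffix gt gs st.
  by move: ms; rewrite sE mem_cat mt orbT.
have [u tE] := greedy_suffix gs gt st; subst t.
move: mt; rewrite mem_cat (negPf ms) orbF => {st}; elim: u gt => // a u IH.
move=> [[Ea _] _ gu]; rewrite inE => /predU1P[->|]; last exact: IH.
by move: Ea; apply: decreasing_sub => //; rewrite size_cat si leq_addl.
Qed.

Lemma pseudo_inter_sub (E : nat -> set nat) : (forall i, E i.+1 `<=` E i) ->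
  pseudo_inter E `<=` E 0.
Proof.
move=> Edec m [s]; elim: s => // a s IH [[Ea _] _ gs].
rewrite inE => /predU1P[->|]; last exact: IH.
by move: Ea; apply: decreasing_sub.
Qed.

Lemma pseudo_inter_unbounded (E : nat -> set nat) :
  (forall i, unbounded (E i)) -> unbounded (pseudo_inter E).
Proof. by move=> Eunb; apply: greedy_set_unbounded. Qed.

(** * Deciding countably many sets *)

(** This is [E `&` C] if that intersection is infinite and [E `\` C]
otherwise.  As a single formula, it is visibly a countable combination of
membership in [E] and [C]. *)
Definition halve (E C : set nat) : set nat :=
  [set m | E m /\ (C m <-> unbounded (E `&` C))].

Lemma halve_unbounded E C : unbounded E -> unbounded (halve E C).
Proof.
move=> Eunb; have [ECunb n|ECbnd n] := pselect (unbounded (E `&` C)).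
  by have [m nm [Em Cm]] := ECunb n; exists m.
have /existsNP[k kEC] := ECbnd.
have [m + Em] := Eunb (maxn n k); rewrite geq_max => /andP[nm km].
by exists m => //; split=> //; split=> // Cm; case: kEC; exists m.
Qed.

Lemma halve_sub E C : halve E C `<=` C \/ halve E C `<=` ~` C.
Proof.
have [ECunb|ECbnd] := pselect (unbounded (E `&` C)); [left|right].
  by move=> m [_ [_ /(_ ECunb)]].
by move=> m [_ [Cm _]] /Cm.
Qed.

Fixpoint halvings (E : set nat) (C : nat -> set nat) (i : nat) : set nat :=
  if i is i'.+1 then halve (halvings E C i') (C i') else E.

(** Sets indexed by a countable type are treated in the order of the codes of
their indices; codes of nothing contribute the harmless [set0]. *)
Definition decide (E : set nat) (T : countType) (C : T -> set nat) : set nat :=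
  pseudo_inter
    (halvings E (fun i => if unpickle i is Some t then C t else set0)).

Lemma halvings_dec E C i : halvings E C i.+1 `<=` halvings E C i.
Proof. by move=> m []. Qed.

Lemma halvings_unbounded E C i : unbounded E -> unbounded (halvings E C i).
Proof. by move=> Eunb; elim: i => //= i; exact: halve_unbounded. Qed.

Lemma decide_sub E (T : countType) (C : T -> set nat) : decide E C `<=` E.
Proof. exact: (@pseudo_inter_sub (halvings E _) (@halvings_dec E _)). Qed.

Lemma decide_unbounded E (T : countType) (C : T -> set nat) :
  unbounded E -> unbounded (decide E C).
Proof.
by move=> Eunb; apply: pseudo_inter_unbounded => i; exact: halvings_unbounded.
Qed.

Lemma decideP E (T : countType) (C : T -> set nat) (t : T) : unbounded E ->
  almost_sub (decide E C) (C t) \/ almost_sub (decide E C) (~` C t).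
Proof.
move=> Eunb; set C' := fun i => if unpickle i is Some t then C t else set0.
have C't : C' (pickle t) = C t by rewrite /C' pickleK.
have := @pseudo_inter_almost (halvings E C') (@halvings_dec E C')
  (fun i => halvings_unbounded C' i Eunb) (pickle t).+1.
rewrite -C't /= => alm.
have [hC|hC] := halve_sub (halvings E C' (pickle t)) (C' (pickle t));
  [left|right].
  exact: almost_subS hC alm.
exact: almost_subS hC alm.
Qed.

(** * Iterated decisions *)

Definition extensions (K : set (seq nat)) (F : seq nat) : set nat :=
  [set m | K (m :: F)].

(** The second component is the family K_j: its members [F] are the sets for
which almost all m_1, ..., almost all m_j in the respective stages put
F + {m_j, ..., m_1} into [K].  Finite sets are represented by sequences. *)
Fixpoint stage (E : set nat) (K : set (seq nat)) (j : nat) :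
    set nat * set (seq nat) :=
  if j is j'.+1 then
    let: (H, L) := stage E K j' in
    let H' := decide H (extensions L) in
    (H', [set F | almost_sub H' (extensions L F)])
  else (E, K).

Definition stage_set E K j : set nat := (stage E K j).1.
Definition stage_fam E K j : set (seq nat) := (stage E K j).2.

Lemma stage_setS E K j :
  stage_set E K j.+1 = decide (stage_set E K j) (extensions (stage_fam E K j)).
Proof. by rewrite /stage_set /stage_fam /=; case: (stage E K j). Qed.

Lemma stage_famS E K j F : stage_fam E K j.+1 F =
  almost_sub (stage_set E K j.+1) (extensions (stage_fam E K j) F).
Proof.
by rewrite stage_setS /stage_set /stage_fam /=; case: (stage E K j).
Qed.

Lemma stage_set_dec E K j : stage_set E K j.+1 `<=` stage_set E K j.
Proof. by rewrite stage_setS; exact: decide_sub. Qed.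

Lemma stage_set_unbounded E K j : unbounded E -> unbounded (stage_set E K j).
Proof.
by move=> Eunb; elim: j => // j; rewrite stage_setS; exact: decide_unbounded.
Qed.

Lemma stage_famNS E K j F : unbounded E -> ~ stage_fam E K j.+1 F ->
  almost_sub (stage_set E K j.+1) (~` extensions (stage_fam E K j) F).
Proof.
move=> Eunb; rewrite stage_famS stage_setS.
by have [] := decideP (extensions (stage_fam E K j)) F
  (stage_set_unbounded K j Eunb).
Qed.

(** Membership in FIN(phi) amounts to avoiding, at some size [N], the family of
the finite sets of points that are heavy for a common measure. *)
Definition avoids (K : set (seq nat)) (A : set nat) (N : nat) :=
  forall F, uniq F -> size F = N -> (forall n, n \in F -> A n) -> ~ K F.

(** If the empty set were in the family of every stage, all the quantifiers
could be read along one pseudo-intersection [D] of the stages, hence along each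
infinite subset of [D], where N successive choices would produce an N-element
member of [K]. *)
Lemma exists_stage_omits_nil E K : unbounded E ->
  (forall D, unbounded D ->
    exists A N, [/\ unbounded A, A `<=` D & avoids K A N]) ->
  exists j, ~ stage_fam E K j [::].
Proof.
move=> Eunb Ktall; apply: contrapT => /forallNP noj.
have {}noj j : stage_fam E K j [::] by apply: contrapT.
have [|A [N [Aunb AD Aavoids]]] := Ktall (pseudo_inter (stage_set E K)).
  by apply: pseudo_inter_unbounded => j; exact: stage_set_unbounded.
have AH j : almost_sub A (stage_set E K j).
  apply: almost_subS AD (@subset_refl _ _) _; apply: pseudo_inter_almost.
    exact: stage_set_dec.
  by move=> i; exact: stage_set_unbounded.
(* F lists the i points picked so far; N - i quantifiers are left *)
suff claim i : i <= N -> exists F, [/\ uniq F, size F = i,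
    (forall n, n \in F -> A n) & stage_fam E K (N - i) F].
  have [F [Funiq FN FA]] := claim N (leqnn N).
  by rewrite subnn; exact: Aavoids.
elim: i => [_|i IH iN]; first by exists [::]; split.
have [F [Funiq Fi FA]] := IH (ltnW iN).
rewrite -[N - i]prednK ?subn_gt0// -subnS stage_famS => Fext.
have [m _ [Am [mext mF]]] := almost_sub_unbounded Aunb (almost_subI
  (almost_sub_trans (AH _) Fext) (almost_sub_above A F)) 0.
exists (m :: F); split=> //=; rewrite ?Fi//.
  by rewrite Funiq andbT; apply/negP => /(allP mF) /=; rewrite ltnn.
by move=> n; rewrite inE => /predU1P[->//|/FA].
Qed.

(** * Thinning a stage *)

(** After the points [s], a new point is acceptable if the sets that it
completes together with points of [s] stay outside the family of the stage
which foresees the number of points still to come. *)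
Definition thin_step E K j (s : seq nat) : set nat :=
  [set m | stage_set E K j m /\ forall F, subseq F s -> size F < j ->
             ~ stage_fam E K (j - (size F).+1) (m :: F)].

Definition thin E K j : set nat := greedy_set (thin_step E K j).

Lemma thin_sub E K j : thin E K j `<=` E.
Proof.
move=> n [s gs ns].
suff : stage_set E K j n.
  exact: (@decreasing_sub (stage_set E K) (@stage_set_dec E K) 0 j (leq0n j)).
elim: s gs ns => // a s IH [[[Ha _] _] _ gs].
by rewrite inE => /predU1P[->//|]; exact: IH.
Qed.

(** A set of points of a greedy sequence arises by adding its latest point to
an earlier set, and [thin_step] guards precisely this step. *)
Lemma greedy_thin E K j s : ~ stage_fam E K j [::] ->
  greedy (thin_step E K j) s -> forall F, subseq F s -> size F <= j ->
  ~ stage_fam E K (j - size F) F.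
Proof.
move=> jnil; elim: s => [_ F|m s IH [[[_ mext] _] _ gs] F].
  by rewrite subseq0 => /eqP -> _; rewrite subn0.
case: F => [|n F] /=; first by rewrite subn0.
case: eqP => [->|_] Fs Fj; first exact: mext.
exact: IH gs _ Fs Fj.
Qed.

(** A finite intersection of sets almost containing [A] almost contains [A];
the induction on [s] splits its subsequences by whether they use the head. *)
Lemma almost_sub_subseq (A : set nat) (C : seq nat -> set nat) s :
  (forall F, subseq F s -> almost_sub A (C F)) ->
  almost_sub A [set m | forall F, subseq F s -> C F m].
Proof.
elim: s C => [|a s IH] C sC.
  apply: almost_subS (sC [::] (sub0seq _)) => // m Cm F.
  by rewrite subseq0 => /eqP ->.
have sC1 F : subseq F s -> almost_sub A (C F).
  by move=> Fs; apply: sC; exact: subseq_trans Fs (subseq_cons s a).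
have sC2 F : subseq F s -> almost_sub A (C (a :: F)).
  by move=> Fs; apply: sC; rewrite /= eqxx.
have := almost_subI (IH _ sC1) (IH (C \o cons a) sC2).
apply: almost_subS => //.
move=> m [Cm Cam] [|n F] /=; first by move=> _; apply: Cm; exact: sub0seq.
by case: eqP => [->|_]; [exact: Cam|exact: Cm].
Qed.

(** The sets outside the family of stage i + 1 have, since stage i + 1 decides,
almost all their one-point extensions outside the family of stage i.  Only
finitely many subsequences of [s] impose a condition. *)
Lemma thin_step_unbounded E K j s : unbounded E -> ~ stage_fam E K j [::] ->
  greedy (thin_step E K j) s -> unbounded (thin_step E K j s).
Proof.
move=> Eunb jnil gs.
suff : almost_sub (stage_set E K j) [set m | forall F, subseq F s ->
    size F < j -> ~ stage_fam E K (j - (size F).+1) (m :: F)].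
  exact/almost_sub_unbounded/stage_set_unbounded.
apply: (@almost_sub_subseq _ (fun F => [set m | size F < j ->
  ~ stage_fam E K (j - (size F).+1) (m :: F)])) => F Fs.
have [Fj|jF] := ltnP (size F) j; last by exists 0.
have := greedy_thin jnil gs Fs (ltnW Fj).
rewrite -[j - size F]prednK ?subn_gt0// -subnS => /(stage_famNS Eunb).
apply: almost_subS => [|m /= mF _//].
by apply: decreasing_sub; [exact: stage_set_dec|lia].
Qed.

Lemma thin_unbounded E K j : unbounded E -> ~ stage_fam E K j [::] ->
  unbounded (thin E K j).
Proof.
move=> Eunb jnil; apply: greedy_set_unbounded => s.
exact: thin_step_unbounded.
Qed.

(** Only subsequences of greedy sequences are controlled by [greedy_thin]; every
finite set of points of [thin] is one of them up to order. *)
Lemma thin_avoids E K j : (forall F F', F =i F' -> K F -> K F') ->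
  ~ stage_fam E K j [::] -> avoids K (thin E K j) j.
Proof.
move=> Kperm jnil F Funiq Fj FA KF.
have [s gs Fs] := greedy_set_seq FA.
have sF : [seq n <- s | n \in F] =i F.
  by move=> n; rewrite mem_filter andb_idr// => /Fs.
have sj : size [seq n <- s | n \in F] = j.
  rewrite -Fj; apply: perm_size; apply: uniq_perm => //.
  exact/filter_uniq/(greedy_uniq gs).
have := greedy_thin jnil gs (filter_subseq _ s) (eq_leq sj).
by rewrite sj subnn; apply; apply: Kperm KF => n; rewrite sF.
Qed.

(** * Borel predicates *)

Definition borel_pred (X : topologicalType) (P : X -> Prop) : Prop :=
  <<s @open X >> [set x | P x].

Lemma borel_ext (X : topologicalType) (P Q : X -> Prop) :
  (forall x, P x <-> Q x) -> borel_pred P -> borel_pred Q.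
Proof.
move=> PQ; rewrite /borel_pred (_ : [set x | P x] = [set x | Q x])//.
by apply/seteqP; split=> x /PQ.
Qed.

Lemma borel_open (X : topologicalType) (A : set X) : open A -> borel_pred A.
Proof. exact: sub_sigma_algebra. Qed.

Lemma borel_not (X : topologicalType) (P : X -> Prop) :
  borel_pred P -> borel_pred (fun x => ~ P x).
Proof.
have [_ + _] := smallest_sigma_algebra [set: X] (@open X).
by move=> C /C; rewrite setTD.
Qed.

(** Closure under quantification over countable types is the only infinitary
rule needed: all the constructions above are arithmetical. *)
Lemma borel_exists (X : topologicalType) (T : countType) (P : T -> X -> Prop) :
  (forall t, borel_pred (P t)) -> borel_pred (fun x => exists t, P t x).
Proof.
have [G0 _ GU] := smallest_sigma_algebra [set: X] (@open X).
move=> PG.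
have := GU (fun i => if unpickle i is Some t then [set x | P t x] else set0).
move=> /(_ _)/borel_ext; apply => [x|n]; last first.
  by case: unpickle => [t|] //; exact: PG.
split=> [[i _]|[t Ptx]]; first by case: unpickle => // t Ptx; exists t.
by exists (pickle t) => //; rewrite pickleK.
Qed.

Lemma borel_forall (X : topologicalType) (T : countType) (P : T -> X -> Prop) :
  (forall t, borel_pred (P t)) -> borel_pred (fun x => forall t, P t x).
Proof.
move=> PG; have := borel_not (borel_exists (fun t => borel_not (PG t))).
apply: borel_ext => x; split=> [h t|h [t]]; last exact.
by apply: contrapT => nP; apply: h; exists t.
Qed.

Lemma borel_const (X : topologicalType) (P : Prop) :
  borel_pred (fun _ : X => P).
Proof.
have [Pt|Pf] := pselect P.
  by apply: (@borel_ext X setT) => //; apply: borel_open; exact: openT.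
by apply: (@borel_ext X set0) => //; apply: borel_open; exact: open0.
Qed.

Lemma borel_imp (X : topologicalType) (P Q : X -> Prop) :
  borel_pred P -> borel_pred Q -> borel_pred (fun x => P x -> Q x).
Proof.
move=> bP bQ.
have := @borel_exists X bool (fun b x => if b then ~ P x else Q x).
move=> /(_ _)/borel_ext; apply=> [x|[]//]; last exact: borel_not.
split=> [[[]//]|PQ].
by have [/PQ|] := pselect (P x); [exists false|exists true].
Qed.

Lemma borel_and (X : topologicalType) (P Q : X -> Prop) :
  borel_pred P -> borel_pred Q -> borel_pred (fun x => P x /\ Q x).
Proof.
move=> bP bQ; have := borel_not (borel_imp bP (borel_not bQ)).
by apply: borel_ext => x; rewrite not_implyP notK.
Qed.

Lemma borel_iff (X : topologicalType) (P Q : X -> Prop) :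
  borel_pred P -> borel_pred Q -> borel_pred (fun x => P x <-> Q x).
Proof. by move=> bP bQ; apply: borel_and; apply: borel_imp. Qed.

Definition borel_setfun (X : topologicalType) (T : Type) (f : X -> set T) :
    Prop :=
  forall t, borel_pred (fun x => f x t).

Lemma borel_unbounded (X : topologicalType) (A : X -> set nat) :
  borel_setfun A -> borel_pred (fun x => unbounded (A x)).
Proof.
move=> bA; apply: borel_forall => n.
have : borel_pred (fun x => exists m, n <= m /\ A x m).
  by apply: borel_exists => m; apply: borel_and => //; exact: borel_const.
by apply: borel_ext => x; split=> [[m []]|[m]]; exists m.
Qed.

Lemma borel_almost_sub (X : topologicalType) (A C : X -> set nat) :
  borel_setfun A -> borel_setfun C ->
  borel_pred (fun x => almost_sub (A x) (C x)).
Proof.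
move=> bA bC; apply: borel_exists => n; apply: borel_forall => m.
by apply: borel_imp; [exact: borel_const|apply: borel_imp].
Qed.

Lemma borel_greedy (X : topologicalType) (P : X -> seq nat -> set nat) s :
  (forall s, borel_setfun (fun x => P x s)) ->
  borel_pred (fun x => greedy (P x) s).
Proof.
move=> bP; have bad s' m : borel_pred (fun x => admissible (P x) s' m).
  by apply: borel_and; [exact: bP|exact: borel_const].
elim: s => [|m s IH] /=; first exact: borel_const.
suff : borel_pred (fun x => admissible (P x) s m /\
    (forall i, i < m -> ~ admissible (P x) s i) /\ greedy (P x) s).
  by apply: borel_ext => x; split=> [[? []]|[]].
apply: borel_and => //; apply: borel_and => //; apply: borel_forall => i.
by apply: borel_imp; [exact: borel_const|exact: borel_not].
Qed.

Lemma borel_greedy_set (X : topologicalType) (P : X -> seq nat -> set nat) :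
  (forall s, borel_setfun (fun x => P x s)) ->
  borel_setfun (fun x => greedy_set (P x)).
Proof.
move=> bP n; have : borel_pred (fun x => exists s, greedy (P x) s /\ n \in s).
  apply: borel_exists => s; apply: borel_and; first exact: borel_greedy.
  exact: borel_const.
by apply: borel_ext => x; split=> [[s []]|[s]]; exists s.
Qed.

Lemma borel_halve (X : topologicalType) (E C : X -> set nat) :
  borel_setfun E -> borel_setfun C -> borel_setfun (fun x => halve (E x) (C x)).
Proof.
move=> bE bC m; apply: borel_and => //; apply: borel_iff => //.
by apply: borel_unbounded => n; exact: borel_and.
Qed.

(** [halve] asks whether an intersection is infinite, which is a countable
combination of membership questions. *)
Lemma borel_decide (X : topologicalType) (T : countType) (E : X -> set nat)
    (C : X -> T -> set nat) :
  borel_setfun E -> (forall t, borel_setfun (fun x => C x t)) ->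
  borel_setfun (fun x => decide (E x) (C x)).
Proof.
move=> bE bC; apply: borel_greedy_set => s; elim: (size s) => //= i IH.
apply: borel_halve => // n.
by case: unpickle => [t|]; [exact: bC|exact: borel_const].
Qed.

Lemma borel_stage (X : topologicalType) (E : X -> set nat) K j :
  borel_setfun E ->
  borel_setfun (fun x => stage_set (E x) K j) /\
  borel_setfun (fun x => stage_fam (E x) K j).
Proof.
move=> bE; elim: j => [|j [bS bF]]; first by split=> // F; exact: borel_const.
have bS' : borel_setfun (fun x => stage_set (E x) K j.+1).
  have := @borel_decide X _ (fun x => stage_set (E x) K j)
    (fun x => extensions (stage_fam (E x) K j)) bS.
  move=> /(_ _) h m; apply: borel_ext (h _ m) => [x|F n]; last exact: bF.
  by rewrite stage_setS.
split=> // F; have := borel_almost_sub bS' (fun m => bF (m :: F)).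
by apply: borel_ext => x; rewrite stage_famS.
Qed.

Lemma borel_thin (X : topologicalType) (E : X -> set nat) K j :
  borel_setfun E ->
  borel_setfun (fun x => thin (E x) K j).
Proof.
move=> bE; apply: borel_greedy_set => s m.
apply: borel_and; first by have [] := borel_stage K j bE.
apply: borel_forall => F; apply: borel_imp; first exact: borel_const.
apply: borel_imp; first exact: borel_const.
by apply: borel_not; have [_] := borel_stage K (j - (size F).+1) bE.
Qed.

(** * Borel maps into the space of infinite sets *)

Definition cylinder (s : seq bool) : set cantor_space :=
  [set x | forall i, i < size s -> x i = nth false s i].

(** The cylinders around a point form a filter base that converges to it,
since each coordinate is eventually fixed. *)
Lemma open_contains_cylinder (O : set cantor_space) x : open O -> O x ->
  exists2 s, cylinder s x & cylinder s `<=` O.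
Proof.
move=> Oopen Ox.
pose F := filter_from [set: nat] (fun n => cylinder (mkseq x n)).
have FF : Filter F.
  apply: filter_from_filter; first by exists 0.
  move=> i j _ _; exists (maxn i j) => // y yij.
  rewrite /cylinder !size_mkseq/= in yij *; split=> k kn;
    by rewrite yij ?nth_mkseq// (leq_trans kn)// ?leq_maxl ?leq_maxr.
have Fx : F --> x.
  apply/cvg_sup => i; apply/cvg_image.
    by apply/seteqP; split=> // b _; exists (fun=> b).
  move=> A xA.
  exists [set y : cantor_space | A (y i)].
    exists i.+1 => // y; rewrite /cylinder size_mkseq => /(_ i (ltnSn i)).
    by rewrite nth_mkseq//= => ->; exact: nbhs_singleton xA.
  apply/seteqP; split=> [b [y Ay <-]//|b Ab]; by exists (fun=> b).
have [n _ nO] := Fx O (open_nbhs_nbhs (conj Oopen Ox)).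
exists (mkseq x n) => // i; rewrite size_mkseq => ni; by rewrite nth_mkseq.
Qed.

Lemma borel_infsub_set : borel_setfun infsub_set.
Proof.
move=> n; apply: borel_open.
exists ((fun x : cantor_space => x n) @^-1` [set true]) => //.
apply: open_comp; last exact: discrete_open.
by move=> x _; exact: (@proj_continuous nat (fun=> bool) n).
Qed.

(** There are countably many cylinders and every open set is a union of them,
so membership of each integer in the value is all that needs to be tested. *)
Lemma borel_fun_infsub (S : infsub -> infsub) :
  borel_setfun (infsub_set \o S) -> borel_fun S.
Proof.
move=> bS B.
apply: (@smallest_sub _ _ _ [set B | borel_pred (S @^-1` B)]) => //.
  split; first exact: borel_const.
  - by move=> A /borel_not; rewrite setTD.
  - by move=> A bA; have := borel_exists bA; apply: borel_ext => x;
      split=> [[n]|[n _]]; exists n.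
move=> _ [U Uopen <-].
have : borel_pred (fun x => exists s : seq bool, cylinder s `<=` U /\
    cylinder s (set_val (S x))).
  apply: borel_exists => s; apply: borel_and; first exact: borel_const.
  apply: borel_forall => i; apply: borel_imp; first exact: borel_const.
  case: (nth false s i); first exact: (bS i).
  have := borel_not (bS i); apply: borel_ext => x.
  by rewrite /= /infsub_set /supp /=; split=> [/negP/negbTE|->].
apply: borel_ext => x; split=> [[s [sU /sU//]]|].
move=> /(open_contains_cylinder Uopen)[s ? ?].
by exists s.
Qed.

Lemma infsub_exists (A : set nat) : unbounded A ->
  exists E : infsub, infsub_set E = A.
Proof.
move=> Aunb; pose x : cantor_space := fun n => `[< A n >].
have xA : supp x = A by apply/seteqP; split=> n /asboolP.
have xinf : infinite_subsets x.
  by rewrite /infinite_subsets /= xA; exact/infinite_unbounded.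
by exists (exist _ x (mem_set xinf)); rewrite -xA.
Qed.

(** The stage used for [E] is the least [j] whose family omits the empty set.
Leastness singles out one [j] by a Borel condition, so the values of the
selector are described by a countable union over [j]. *)
Theorem avoids_borel_selector (K : set (seq nat)) :
  (forall F F', F =i F' -> K F -> K F') ->
  (forall D, unbounded D ->
    exists A N, [/\ unbounded A, A `<=` D & avoids K A N]) ->
  exists S : infsub -> infsub, borel_fun S /\
    forall E, infsub_set (S E) `<=` infsub_set E /\
      exists N, avoids K (infsub_set (S E)) N.
Proof.
move=> Kperm Ktall.
have unb (E : infsub) : unbounded (infsub_set E).
  by apply/infinite_unbounded; have := set_valP E.
pose least_stage (E : infsub) j := ~ stage_fam (infsub_set E) K j [::] /\
  forall i, i < j -> stage_fam (infsub_set E) K i [::].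
have least_stage_ex E : exists j, least_stage E j.
  have [j jnil] := exists_stage_omits_nil (unb E) Ktall.
  have jex : exists j, `[< ~ stage_fam (infsub_set E) K j [::] >].
    by exists j; apply/asboolP.
  have [i /asboolP inil imin] := ex_minnP jex; exists i; split=> // k ki.
  apply: contrapT => /asboolP /imin; by rewrite leqNgt ki.
have least_stage_uniq E i j : least_stage E i -> least_stage E j -> i = j.
  move=> [inil imin] [jnil jmin].
  by have [/jmin/inil|/imin/jnil|] := ltngtP i j.
have Sex (E : infsub) : exists E' : infsub,
    forall j, least_stage E j -> infsub_set E' = thin (infsub_set E) K j.
  have [j Ej] := least_stage_ex E.
  have [E' E'E] := infsub_exists (thin_unbounded (unb E) (proj1 Ej)).
  by exists E' => i /(least_stage_uniq _ _ _ Ej) <-.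
pose S E := projT1 (cid (Sex E)).
have SE E j : least_stage E j -> infsub_set (S E) = thin (infsub_set E) K j.
  by rewrite /S; case: cid => E' /= /[apply].
exists S; split; last first.
  move=> E; have [j Ej] := least_stage_ex E; rewrite (SE _ _ Ej); split.
    exact: thin_sub.
  by exists j; apply: thin_avoids => //; have [] := Ej.
apply: borel_fun_infsub => n.
have : borel_pred (fun E =>
    exists j, least_stage E j /\ thin (infsub_set E) K j n).
  apply: borel_exists => j; apply: borel_and; last first.
    exact: borel_thin borel_infsub_set n.
  apply: borel_and.
    by apply: borel_not; have [_] := borel_stage K j borel_infsub_set.
  apply: borel_forall => i; apply: borel_imp; first exact: borel_const.
  by have [_] := borel_stage K i borel_infsub_set.
apply: borel_ext => E; split=> [[j [Ej]]|].
  by rewrite /= (SE _ _ Ej).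
by have [j Ej] := least_stage_ex E; rewrite /= (SE _ _ Ej); exists j.
Qed.

(** * Masses of points and membership in FIN *)

Local Open Scope ring_scope.
Local Open Scope ereal_scope.

Lemma setU_cons (T : eqType) (x : T) (s : seq T) :
  [set` x :: s] = [set x] `|` [set` s].
Proof.
apply/seteqP; split=> y /=; first by rewrite inE => /predU1P[]; [left|right].
by case=> [->|ys]; rewrite inE ?eqxx ?ys ?orbT.
Qed.

Lemma measure_seq_le (R : realType) (mu : {measure set nat -> \bar R})
    (s : seq nat) :
  (forall n, mu [set n] <= 1) -> mu [set` s] <= (size s)%:R%:E.
Proof.
move=> mu1; elim: s => [|n s IH].
  by rewrite set_nil measure0.
rewrite setU_cons /= -add1n natrD EFinD.
apply: le_trans (measureU2 mu _ _) _ => //; apply: leeD; [exact: mu1|exact: IH].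
Qed.

Lemma measure_seq_ge (R : realType) (mu : {measure set nat -> \bar R})
    (s : seq nat) (c : R) : uniq s ->
  (forall n, n \in s -> c%:E <= mu [set n]) -> (c *+ size s)%:E <= mu [set` s].
Proof.
elim: s => [|n s IH] /=; first by rewrite mulr0n.
move=> /andP[ns suniq] cs; rewrite setU_cons measureU//; last first.
  by apply/seteqP; split=> // m [/= ->]; rewrite (negPf ns).
rewrite mulrS EFinD leeD//; first by rewrite cs ?mem_head.
by apply: IH => // m ms; rewrite cs// inE ms orbT.
Qed.

Lemma measure_le_card (R : realType) (mu : {measure set nat -> \bar R})
    (A : set nat) (N : nat) : (forall n, mu [set n] <= 1) ->
  (forall s : seq nat, uniq s -> size s = N -> ~ [set` s] `<=` A) ->
  mu A <= N%:R%:E.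
Proof.
move=> mu1 noN.
have short (s : seq nat) : uniq s -> [set` s] `<=` A -> (size s <= N)%N.
  move=> suniq sA; rewrite leqNgt; apply/negP => Ns.
  apply: (noN (take N s)); rewrite ?take_uniq ?size_takel// 1?ltnW//.
  by move=> n /= /mem_take /sA.
have [/finite_seqP[s As]|Ainf] := pselect (finite_set A).
  have us : [set` undup s] = A.
    by rewrite As; apply/seteqP; split=> n /=; rewrite mem_undup.
  rewrite -us; apply: le_trans (measure_seq_le _ mu1) _.
  by rewrite lee_fin ler_nat short ?undup_uniq ?us.
have [B BA NB] := infinite_set_fset N.+1 Ainf.
by have := short _ (finmap.fset_uniq B) BA; rewrite leqNgt NB.
Qed.

(** The least i with 2^-i < x is positive, and its predecessor is the index
of the shell. *)
Lemma dyadic_shell (R : realType) (x : R) : (0 < x <= 1)%R ->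
  exists i, (2 ^- i.+1 < x <= 2 ^- i)%R.
Proof.
move=> /andP[x0 x1].
have iex : exists i, (2 ^- i < x)%R.
  exists (Num.bound x^-1)%R.
  rewrite -[ltRHS]invrK ltf_pV2 ?posrE ?invr_gt0 ?exprn_gt0//.
  apply: lt_trans (archi_boundP _) _; first by rewrite invr_ge0 ltW.
  by rewrite -natrX ltr_nat ltn_expl.
have [[|i] ix imin] := ex_minnP iex.
  by move: ix; rewrite expr0 invr1 ltNge x1.
exists i; rewrite ix/= leNgt; apply/negP => /imin; by rewrite ltnn.
Qed.

(** Each shell of index i > p contains at most one point, of mass at most
2^-i, and shells of index at most p do not meet [A]; the masses sum up to at
most 2.  The points of mass zero form a null set by countable
subadditivity. *)
Lemma small_part_le (R : realType) (mu : {measure set nat -> \bar R})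
    (A : set nat) (p : nat) :
  (forall n, A n -> mu [set n] <= (2 ^- p.+1)%R%:E) ->
  (forall n m i, (p < i)%N ->
    (2 ^- i.+1)%R%:E < mu [set n] <= (2 ^- i)%R%:E ->
    (2 ^- i.+1)%R%:E < mu [set m] <= (2 ^- i)%R%:E -> n = m) ->
  mu A <= 2%:E.
Proof.
move=> Asmall shell1.
pose D i := A `&` [set n | (2 ^- i.+1)%R%:E < mu [set n] <= (2 ^- i)%R%:E].
pose Z n := [set m | m = n /\ mu [set n] = 0].
have ADZ : A `<=` \bigcup_i D i `|` \bigcup_n Z n.
  move=> n An; have [mun0|mun0] := pselect (mu [set n] = 0).
    by right; exists n.
  left; have munfin : mu [set n] \is a fin_num.
    by rewrite ge0_fin_numE//; apply: le_lt_trans (Asmall n An) _; rewrite ltry.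
  have [|i xi] := @dyadic_shell R (fine (mu [set n])); last first.
    exists i => //; split=> //=.
    by rewrite -[mu [set n]]fineK// lte_fin lee_fin.
  rewrite fine_gt0 ?lt0e ?measure_ge0 ?andbT ?ltey_eq ?munfin/= ?andbT;
    last exact/eqP.
  rewrite -lee_fin fineK//; apply: le_trans (Asmall n An) _.
  by rewrite lee_fin invf_le1 ?exprn_gt0// exprn_ege1// ler1n.
have muZ : mu (\bigcup_n Z n) = 0.
  apply/eqP; rewrite eq_le measure_ge0 andbT.
  apply: le_trans (measure_sigma_subadditive mu _ _ (@subset_refl _ _)) _ => //.
  rewrite eseries0// => n _ _.
  have [n0|n0] := pselect (mu [set n] = 0).
    by rewrite (_ : Z n = [set n])//; apply/seteqP; split=> m // [].
  by rewrite (_ : Z n = set0) ?measure0//; apply/seteqP; split=> m // [].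
have muD i : mu (D i) <= (2 / (2 ^ i.+1)%:R)%R%:E.
  have [D0|/set0P[n [An ni]]] := eqVneq (D i) set0.
    by rewrite D0 measure0 lee_fin.
  have pi : (p < i)%N.
    rewrite ltnNge; apply/negP => ip; case/andP: ni => + _.
    apply/negP; rewrite -leNgt; apply: le_trans (Asmall n An) _.
    by rewrite lee_fin lef_pV2 ?posrE ?exprn_gt0// ler_weXn2l// ler1n.
  rewrite (_ : D i = [set n]).
    case/andP: ni => _ /le_trans; apply.
    by rewrite lee_fin natrX exprS invfM mulrA divff// mul1r.
  by apply/seteqP; split=> m => [[_ mi]|->//]; exact: shell1 mi ni.
apply: le_trans (le_measure _ _ _ ADZ) _; rewrite ?inE//.
apply: (@le_trans _ _ (mu (\bigcup_i D i) + mu (\bigcup_n Z n))).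
  exact: measureU2.
rewrite muZ adde0.
apply: le_trans (measure_sigma_subadditive mu _ _ (@subset_refl _ _)) _ => //.
apply: (@le_trans _ _ (\sum_(i <oo) (2 / (2 ^ i.+1)%:R)%R%:E)).
  exact: lee_nneseries.
exact: epsilon_trick0.
Qed.

Definition big_families (R : realType) (mu : nat -> {measure set nat -> \bar R})
    (c : R) : set (seq nat) :=
  [set F | exists k, forall n, n \in F -> c%:E < mu k [set n]].

(** Split [A] along the heavy points of mu_k: there are at most [N] of them in
[A], each of mass at most 1, and the others weigh at most 2 in total.  The
bound N + 2 does not depend on k. *)
Lemma avoids_FIN (R : realType) (mu : nat -> {measure set nat -> \bar R})
    (p N : nat) (A : set nat) :
  (forall n k, mu k [set n] <= 1) ->
  (forall n m i, n <> m -> (p < i)%N ->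
    assoc_partition mu n (Some i) `&` assoc_partition mu m (Some i) = set0) ->
  avoids (big_families mu (2 ^- p.+1)%R) A N -> FIN (sup_measure mu) A.
Proof.
move=> mu1 disj Aav; apply: (@le_lt_trans _ _ ((N%:R)%:E + 2%:E)); last first.
  by rewrite -EFinD ltry.
apply: ge_ereal_sup => _ [k _ <-].
set B := [set n | (2 ^- p.+1)%R%:E < mu k [set n]].
apply: (@le_trans _ _ (mu k (A `&` B `|` A `\` B))).
  by rewrite setUIDK.
apply: le_trans (measureU2 (mu k) _ _) _ => //; apply: leeD.
  apply: measure_le_card => // s suniq sN sAB.
  apply: (Aav s suniq sN) => [n ns|]; first by have [] := sAB n ns.
  by exists k => n ns; have [] := sAB n ns.
apply: (@small_part_le _ _ _ p) => [n [_]|n m i pi ni mi].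
  by move=> /negP; rewrite -leNgt.
apply: contrapT => nm; have /seteqP[+ _] := disj n m i nm pi.
by move=> /(_ k); apply; split; apply/andP.
Qed.

(** [N] points of mass at least [c] have mass at least N c, which exceeds
phi(A) for large [N]. *)
Lemma FIN_avoids (R : realType) (mu : nat -> {measure set nat -> \bar R})
    (c : R) (A : set nat) : (0 < c)%R ->
  FIN (sup_measure mu) A -> exists N, avoids (big_families mu c) A N.
Proof.
move=> c0 Afin.
have [M muM] : exists M : R, forall k, mu k A <= M%:E.
  have supfin : sup_measure mu A \is a fin_num.
    rewrite ge0_fin_numE//; apply: le_trans (measure_ge0 (mu 0%N) A) _.
    by apply: ereal_sup_ubound; exists 0%N.
  exists (fine (sup_measure mu A)) => k; rewrite fineK//.
  by apply: ereal_sup_ubound; exists k.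
exists (Num.bound (`|M| / c))%R => F Funiq FN FA [k Fk].
have : (c *+ size F)%:E <= M%:E.
  apply: le_trans (@measure_seq_ge _ (mu k) F c Funiq _) (le_trans _ (muM k)).
    by move=> n nF; apply/ltW/Fk.
  by apply: le_measure; rewrite ?inE.
apply/negP; rewrite -ltNge lte_fin FN -mulr_natl -ltr_pdivrMr//.
apply: le_lt_trans (archi_boundP _); last by rewrite divr_ge0// ltW.
by rewrite ler_pM2r ?invr_gt0// ler_norm.
Qed.

Theorem theorem4p14 (R : realType)
    (mu : nat -> {measure set nat -> \bar R})
    (mu_le1 : forall n k : nat, mu k [set n] <= 1)
    (mu_disj : eventually_disjoint (assoc_partition mu))
    (fin_tall : tall (FIN (sup_measure mu))) :
  has_borel_selector (FIN (sup_measure mu)).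
Proof.
have [p disj] := mu_disj.
have [||S [Sborel SE]] :=
  @avoids_borel_selector (big_families mu (2 ^- p.+1)%R).
- by move=> F F' FF' [k Fk]; exists k => n; rewrite -FF'; exact: Fk.
- move=> D /infinite_unbounded /fin_tall[A [/infinite_unbounded Aunb AD]].
  have c0 : (0 < 2 ^- p.+1 :> R)%R by rewrite invr_gt0 exprn_gt0.
  by move=> /(FIN_avoids c0)[N AN]; exists A, N.
exists S; split=> // E; have [SEE [N SN]] := SE E; split=> //.
exact: avoids_FIN mu_le1 disj SN.
Qed.
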